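(* For every prime power $q\ge 2$, there is no $5$-$(24,8,1)_q$ design (i.e. the large Witt design, with parameters $5$-$(24,8,1)$, has no $q$-analog).
   Context: For a $v$-dimensional vector space $V$ over the finite field $\mathrm{GF}(q)$, a pair $(V,\mathcal{B})$ with $\mathcal{B}$ a set of $k$-dimensional subspaces of $V$ (called blocks) is a $t$-$(v,k,\lambda)_q$ (subspace) design if every $t$-dimensional subspace of $V$ is contained in exactly $\lambda$ elements of $\mathcal{B}$. *)

(* Defs.v *)
From HB Require Import structures.
From mathcomp Require Import all_boot all_order all_algebra.
From mathcomp Require Import finmap.

Set Implicit Arguments.
Unset Strict Implicit.
Unset Printing Implicit Defensive.

Local Open Scope fset_scope.

Definition prime_power (q : nat) : Prop :=
  exists p m : nat, [/\ prime p, 0 < m & q = p ^ m].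

(* (V, B) is a t-(v, k, lambda)_q design with q = #|F|. A vector space of
   finite dimension over F has finitely many subspaces, so letting B range over
   finite sets is no restriction. *)
Definition subspace_design (F : finFieldType) (V : vectType F)
    (B : {fset {vspace V}}) (t v k lambda : nat) : Prop :=
  [/\ \dim {:V} = v,
      forall U : {vspace V}, U \in B -> \dim U = k &
      forall T : {vspace V}, \dim T = t ->
        #|` [fset U in B | (T <= U)%VS]| = lambda].

(* Main.v *)
(* Counting vectors v outside an i-dimensional subspace S shows that the number
   n_i of blocks containing S satisfies
   n_i (q^8 - q^i) = (q^24 - q^i) n_{i+1}, starting from n_5 = 1.  Hence
   n_2 (q^6 - 1)(q^5 - 1)(q^4 - 1) = (q^22 - 1)(q^21 - 1)(q^20 - 1),
   and the cyclotomic factor q^2 - q + 1 of the left-hand side cannot be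
   absorbed by the right-hand side. *)
Require Import Defs.
From mathcomp Require Import all_boot all_order all_algebra all_field.
From mathcomp Require Import finmap.
From mathcomp Require Import zify ring.

Set Implicit Arguments.
Unset Strict Implicit.
Unset Printing Implicit Defensive.

Import Order.TTheory GRing.Theory Num.Theory.

Lemma card_vspaceD (F : finFieldType) (V : vectType F) (S U : {vspace V}) :
  (S <= U)%VS ->
  #|[pred v : finvect_type V | ((v : V) \in U) && ((v : V) \notin S)]|
    = #|F| ^ \dim U - #|F| ^ \dim S.
Proof.
move=> SU.
(* [card_vspace] expects a vector structure carried by a finite type; destructing [V] lets
   [finvect_type] provide one on the same carrier. *)
have cV (W : {vspace V}) : #|[pred v : finvect_type V | (v : V) \in W]| = #|F| ^ \dim W.
  case: V {S U SU} W => T cT W.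
  by rewrite -(@card_vspace F (finvect_type (Vector.Pack cT)) cT W).
rewrite -!cV -(cardID [pred v : finvect_type V | (v : V) \in S]
  [pred v : finvect_type V | (v : V) \in U]).
have -> : #|[predI [pred v : finvect_type V | (v : V) \in U]
           & [pred v : finvect_type V | (v : V) \in S]]| =
          #|[pred v : finvect_type V | (v : V) \in S]|.
  by apply: eq_card => v; rewrite !inE andb_idl // => /(subvP SU).
by rewrite addKn; apply: eq_card => v; rewrite !inE andbC.
Qed.

(* Double counting of the pairs (v, U) with v \in U, v \notin S and S <= U. *)
Lemma count_superspaces_rec (F : finFieldType) (V : vectType F)
    (B : seq {vspace V}) (k c : nat) (S : {vspace V}) :
    (forall U, U \in B -> \dim U = k) ->
    (forall v, v \notin S -> count (fun U => S + <[v]> <= U)%VS B = c) ->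
  count (fun U => S <= U)%VS B * (#|F| ^ k - #|F| ^ \dim S)
    = (#|F| ^ \dim {:V} - #|F| ^ \dim S) * c.
Proof.
move=> dimB cS.
rewrite -(card_vspaceD (subvf S)) -sum1_count big_distrl /= -sum_nat_const.
transitivity (\sum_(v in [pred v : finvect_type V |
    ((v : V) \in {:V}%VS) && ((v : V) \notin S)])
    \sum_(U <- B | (S + <[v : V]> <= U)%VS) 1); last first.
  by apply: eq_bigr => v /andP[_ /cS <-]; rewrite sum1_count.
rewrite (exchange_big_dep (fun U => S <= U)%VS) /=; last first.
  by move=> v U _; rewrite subv_add => /andP[].
rewrite big_seq_cond [RHS]big_seq_cond; apply: eq_bigr => U /andP[/dimB dimU SU].
(* For a fixed block U above S, the condition on v reduces to v in U outside S, so each such block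
   contributes q^k - q^(dim S). *)
rewrite mul1n -dimU -(card_vspaceD SU) -sum1_card; apply: eq_bigl => v.
by rewrite !inE memvf subv_add SU /= -memvE andbC.
Qed.

Lemma dimv_add_line (F : fieldType) (V : vectType F) (S : {vspace V}) v :
  v \notin S -> \dim (S + <[v]>) = (\dim S).+1.
Proof.
move=> vS; have v0 : v != 0%R by apply: contraNneq vS => ->; exact: mem0v.
rewrite dimv_disjoint_sum ?dim_vline ?v0 ?addn1 //.
apply/eqP; rewrite -subv0; apply/subvP => w /memv_capP[wS /vlineP[a aw]].
move: wS; rewrite aw; have [->|a0] := eqVneq a 0%R; first by move=> _; rewrite scale0r mem0v.
by rewrite rpredZeq (negPf a0) (negPf vS).
Qed.

Lemma exists_subspace_dim (F : fieldType) (V : vectType F) (n : nat) :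
  n <= \dim {:V} -> exists S : {vspace V}, \dim S = n.
Proof.
elim: n => [|n IHn] le_n; first by exists 0%VS; rewrite dimv0.
have [S dimS] := IHn (ltnW le_n).
have /subvPn[v _ vS] : ~~ ({:V} <= S)%VS.
  by apply: contraL le_n => /dimvS; rewrite dimS -leqNgt.
by exists (S + <[v]>)%VS; rewrite dimv_add_line ?dimS.
Qed.

Lemma count_fset (T : choiceType) (B : {fset T}) (P : pred T) :
  #|` [fset x in B | P x]%fset| = count P B.
Proof. by rewrite card_fset_sum1 big_fset sum1_count. Qed.

Section WittObstruction.
Local Open Scope ring_scope.

(* The factor Phi_6(q) = q^2 - q + 1 of q^6 - 1 is odd and greater than 1, but
   the right-hand sides multiply up to -2 modulo Phi_6(q), where q^3 = -1. *)
Lemma witt_divisibility_obstruction (q x2 x3 x4 : int) : 2 <= q ->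
  x4 * (q ^+ 8 - q ^+ 4) = q ^+ 24 - q ^+ 4 ->
  x3 * (q ^+ 8 - q ^+ 3) = (q ^+ 24 - q ^+ 3) * x4 ->
  x2 * (q ^+ 8 - q ^+ 2) = (q ^+ 24 - q ^+ 2) * x3 -> False.
Proof.
move=> q_ge2 e4 e3 e2.
pose m : int := q ^+ 2 - q + 1.
(* A = (q^22 - 1)/(q^2 - 1) and D = (q^20 - 1)/(q^4 - 1). *)
pose A : int := \sum_(i < 11) q ^+ (2 * i).
pose D : int := \sum_(i < 5) q ^+ (4 * i).
have q0 : q != 0 by lia.
have qX1 n : (0 < n)%N -> q ^+ n - 1 != 0.
  move=> n_gt0; rewrite subr_eq0 gt_eqF // exprn_egt1 -?lt0n //; lia.
have {}e4 : x4 = D.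
  apply: (mulIf (mulf_neq0 (expf_neq0 4 q0) (qX1 4%N isT))).
  transitivity (q ^+ 24 - q ^+ 4); first by rewrite -e4; ring.
  by rewrite /D !big_ord_recr big_ord0 /=; ring.
have {}e3 : x3 * (q ^+ 5 - 1) = (q ^+ 21 - 1) * D.
  apply: (mulfI (expf_neq0 3 q0)); rewrite -e4.
  transitivity ((q ^+ 24 - q ^+ 3) * x4); last by ring.
  by rewrite -e3; ring.
(* Cancel q^2 (q^2 - 1), using (q^6 - 1)/(q^2 - 1) = q^4 + q^2 + 1 = (q^2 + q + 1) m. *)
have {}e2 : x2 * ((q ^+ 2 + q + 1) * m) = A * x3.
  apply: (mulfI (mulf_neq0 (expf_neq0 2 q0) (qX1 2%N isT))).
  transitivity ((q ^+ 24 - q ^+ 2) * x3); first by rewrite -e2 /m; ring.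
  by rewrite /A !big_ord_recr big_ord0 /=; ring.
(* Modulo m, q^6 = 1 and 1 + q^2 + q^4 = 0: the first nine terms of A vanish in threes, leaving q^18
   + q^20 = 1 + q^2 = q. *)
have [a Aa] : exists a, A = q + m * a.
  exists ((q ^+ 2 + q + 1) * (1 + q ^+ 6 + q ^+ 12) + q ^+ 18
    + q * ((q ^+ 3 - 1) * (q + 1) * (1 + q ^+ 6 + q ^+ 12))).
  by rewrite /m /A !big_ord_recr big_ord0 /=; ring.
(* q^21 + 1 is divisible by q^3 + 1 = (q + 1) m. *)
have [t Tt] : exists t, q ^+ 21 - 1 = - 2 + m * t.
  exists ((q + 1) * (q ^+ 18 - q ^+ 15 + q ^+ 12 - q ^+ 9 + q ^+ 6 - q ^+ 3 + 1)).
  by rewrite /m; ring.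
(* Modulo m, the terms of D are 1, q^4, q^2, 1, q^4, that is 2 (1 + q^2 + q^4) - q^2. *)
have [d Dd] : exists d, D = - q ^+ 2 + m * d.
  exists (2 * (q ^+ 2 + q + 1)
    + (q ^+ 2 + (q ^+ 6 + 1) * (1 + q ^+ 4)) * ((q ^+ 3 - 1) * (q + 1))).
  by rewrite /m /D !big_ord_recr big_ord0 /=; ring.
have eATD : x2 * (q ^+ 2 + q + 1) * (q ^+ 5 - 1) * m = A * (q ^+ 21 - 1) * D.
  transitivity (x2 * ((q ^+ 2 + q + 1) * m) * (q ^+ 5 - 1)); first by ring.
  by rewrite e2 -mulrA e3 mulrA.
(* Modulo m, the product in [eATD] is both 0 and q (-2) (-q^2) = 2 q^3. The witness comes from 2 = 2
   (q + 1) m - 2 q^3 by expanding that product. *)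
have [z mz] : exists z, 2 = m * z.
  exists (2 * (q + 1) - x2 * (q ^+ 2 + q + 1) * (q ^+ 5 - 1)
     + a * (- 2 + m * t) * (- q ^+ 2 + m * d)
     + q * t * (- q ^+ 2 + m * d) - 2 * q * d).
  have -> : m * (2 * (q + 1) - x2 * (q ^+ 2 + q + 1) * (q ^+ 5 - 1)
     + a * (- 2 + m * t) * (- q ^+ 2 + m * d)
     + q * t * (- q ^+ 2 + m * d) - 2 * q * d) =
     m * (2 * (q + 1)) - x2 * (q ^+ 2 + q + 1) * (q ^+ 5 - 1) * m
     + (q + m * a) * (- 2 + m * t) * (- q ^+ 2 + m * d) - 2 * q ^+ 3 by ring.
  by rewrite eATD Aa Tt Dd /m; ring.
(* Being at least 3, m cannot divide 2: m z is at most 0 or at least 3. *)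
have m_ge3 : 3 <= m.
  rewrite -subr_ge0; have -> : m - 3 = (q - 2) * (q + 1) by rewrite /m; ring.
  by apply: mulr_ge0; lia.
have m_ge0 : 0 <= m by apply: le_trans m_ge3.
have [z_le0|z_gt0] := lerP z 0.
  by have := mulr_ge0_le0 m_ge0 z_le0; rewrite -mz.
have : 3 * 1 <= m * z by apply: ler_pM => //; lia.
by rewrite -mz.
Qed.

End WittObstruction.

(** The right-hand side of [count_superspaces_rec] depends on S only through its dimension, and the
    factor q^k - q^i is positive as i < k, so it cancels. A sample subspace [S0] supplies the common
    value. *)
Lemma block_counts_lower_dim (F : finFieldType) (V : vectType F)
    (B : seq {vspace V}) (k c i : nat) :
    (forall U, U \in B -> \dim U = k) -> i < k -> i <= \dim {:V} ->
    (forall S : {vspace V}, \dim S = i.+1 ->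
       count (fun U => S <= U)%VS B = c) ->
  exists2 c', c' * (#|F| ^ k - #|F| ^ i) = (#|F| ^ \dim {:V} - #|F| ^ i) * c &
    forall S : {vspace V}, \dim S = i -> count (fun U => S <= U)%VS B = c'.
Proof.
move=> dimB lt_ik le_iV cB.
have rec (S : {vspace V}) : \dim S = i ->
    count (fun U => S <= U)%VS B * (#|F| ^ k - #|F| ^ i)
      = (#|F| ^ \dim {:V} - #|F| ^ i) * c.
  move=> dimS; rewrite -dimS; apply: count_superspaces_rec => // v vS.
  by rewrite cB // dimv_add_line ?dimS.
have [S0 dimS0] := exists_subspace_dim le_iV.
exists (count (fun U => S0 <= U)%VS B); first exact: rec.
move=> S dimS; apply/eqP; rewrite -(@eqn_pmul2r (#|F| ^ k - #|F| ^ i)) ?rec //.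
by rewrite subn_gt0 ltn_exp2l // finNzRing_gt1.
Qed.

Theorem mainTheorem4 (q : nat) (q_pp : prime_power q)
    (F : finFieldType) (cardF : #|F| = q)
    (V : vectType F) (B : {fset {vspace V}}) :
  ~ subspace_design B 5 24 8 1.
Proof.
case=> dimV dimB design.
have q_gt1 : 1 < q by rewrite -cardF finNzRing_gt1.
have count5 (T : {vspace V}) : \dim T = 5 -> count (fun U => T <= U)%VS B = 1.
  by move=> dimT; rewrite -count_fset design.
have [n4 e4 count4] := block_counts_lower_dim dimB (isT : 4 < 8)
  ltac:(by rewrite dimV) count5.
have [n3 e3 count3] := block_counts_lower_dim dimB (isT : 3 < 8)
  ltac:(by rewrite dimV) count4.
have [n2 e2 _] := block_counts_lower_dim dimB (isT : 2 < 8)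
  ltac:(by rewrite dimV) count3.
move: e4 e3 e2; rewrite cardF dimV muln1.
(* Subtraction on [nat] truncates, so passing to integers needs a <= b. *)
have intB a b : a <= b -> Posz (q ^ b - q ^ a) = (Posz q ^+ b - Posz q ^+ a)%R.
  by move=> le_ab; rewrite -subzn ?leq_pexp2l ?(ltnW q_gt1) // -!natz !natrX.
move=> /(congr1 Posz) + /(congr1 Posz) + /(congr1 Posz).
by rewrite !PoszM !intB //; apply: witt_divisibility_obstruction.
Qed.
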